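(* Let $C_{\mathrm{cont}}:\ a_cx_c+a_rx_r+\sum_{j\notin\{r,c\}}a_jx_j\ge b$ be a constraint of a mixed binary program propagating a continuous variable $x_c\in[\ell_c,u_c]$ in the state $\rho_1$. Further, assume that the bound change on the continuous variable $x_c$ is non-relaxable for a constraint $C_{\mathrm{reason}}:\ a'_cx_c+a'_rx_r+\sum_{j\notin\{r,c\}}a'_jx_j\ge b'$ that propagates a variable $x_r$ in a later state $\rho_2$. Then the linear combination of $C_{\mathrm{reason}}$ and $C_{\mathrm{cont}}$ that eliminates $x_c$ propagates $x_r$ at least as strongly as $C_{\mathrm{reason}}$, in the sense that in $\rho_2$ it gives the same or a better bound on $x_r$ than $C_{\mathrm{reason}}$.
   Context: Setting: a mixed binary program with variables $x\in\mathbb{R}^n$, global bounds $\ell_j\le x_j\le u_j$, where the variables in an index set $\mathcal{I}$ are binary (integer with global bounds $0$ and $1$) and the remaining variables are continuous. Constraints are linear inequalities with real coefficients. States: a state $\rho$ carries local bounds $\ell^\rho_j\le u^\rho_j$ for all variables, within the global bounds. Bounds are only tightened over time, so for the later state $\rho_2$ one has $[\ell^{\rho_2},u^{\rho_2}]\subseteq[\ell^{\rho_1},u^{\rho_1}]$. Here $\rho_2$ denotes the local bounds with which $C_{\mathrm{reason}}$ is propagated; in particular the bounds of $x_r$ in $\rho_2$ are those before the bound change on $x_r$ derived from $C_{\mathrm{reason}}$. Propagation: for a constraint $C:\sum_j\alpha_jx_j\ge\beta_0$ with $\alpha_s\neq0$, the bound on $x_s$ derived from $C$ in $\rho$ is $$\beta:=\frac1{\alpha_s}\Big(\beta_0-\sum_{j\ne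 s}\max\{\alpha_j\ell^\rho_j,\alpha_ju^\rho_j\}\Big),$$ a lower bound $x_s\ge\beta$ if $\alpha_s>0$ and an upper bound $x_s\le\beta$ if $\alpha_s<0$. $C$ propagates $x_s$ in $\rho$ if $\beta$ is finite and this bound (rounded to the next integer in the valid direction if $x_s$ is binary) is strictly tighter than the previous local bound. For a continuous variable no rounding takes place, so the new local bound of $x_c$ is exactly the $\beta$ derived from $C_{\mathrm{cont}}$ in $\rho_1$. Non-relaxable: a variable $x_j$ is relaxable for a constraint under a state $\rho$ if the constraint's maximal activity $\sum_i\max\{\alpha_i\ell_i^\rho,\alpha_iu_i^\rho\}$ is unchanged when the local bounds of $x_j$ are replaced by its global bounds; this holds iff $\alpha_j=0$, or $\alpha_j>0$ and $u_j^\rho=u_j$, or $\alpha_j<0$ and $\ell_j^\rho=\ell_j$. Otherwise it is non-relaxable. That the bound change on $x_c$ (made by $C_{\mathrm{cont}}$) is non-relaxable for $C_{\mathrm{reason}}$ means that $x_c$ is non-relaxable for $C_{\mathrm{reason}}$ under $\rho_2$ and that the local bound of $x_c$ entering the maximal activity of $C_{\mathrm{reason}}$ under $\rho_2$ is precisely the bound set by $C_{\mathrm{cont}}$: i.e. either $C_{\mathrm{cont}}$ propagated a lower bound ($a_c>0$), $a'_c<0$, and $\ell_c^{\rho_2}$ equals that derived bound; or $C_{\mathrm{cont}}$ propagated an upper bound ($a_c<0$), $a'_c>0$, and $u_c^{\rho_2}$ equals that derived bound. Linear combination eliminating $x_c$: the combination of the two constraints with positive multipliers, unique up to positive scaling,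 in which the coefficient of $x_c$ is zero, e.g. $|a_c|\cdot C_{\mathrm{reason}}+|a'_c|\cdot C_{\mathrm{cont}}$. ''Same or better bound'': let $\beta$ be the (unrounded) bound on $x_r$ derived from $C_{\mathrm{reason}}$ in $\rho_2$. A constraint $C$ gives the same or a better bound in $\rho_2$ if every point $x\in[\ell^{\rho_2},u^{\rho_2}]$ satisfying $C$ satisfies $x_r\ge\beta$ when $a'_r>0$, respectively $x_r\le\beta$ when $a'_r<0$. (If no point of the box satisfies $C$, then $C$ shows infeasibility in $\rho_2$, which counts as at least as strong.) *)

(* Defs.v *)
From HB Require Import structures.
From mathcomp Require Import all_boot all_order all_algebra.
From mathcomp Require Import reals constructive_ereal.

Set Implicit Arguments.
Unset Strict Implicit.
Unset Printing Implicit Defensive.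

Import Order.TTheory GRing.Theory Num.Theory.
Local Open Scope ring_scope.

(* The pair (a, b) stands for the inequality \sum_j a 0 j * x_j >= b. *)
Definition constraint (R : realType) (n : nat) : Type := ('rV[R]_n * R)%type.

Definition coef (R : realType) (n : nat) (C : constraint R n) (j : 'I_n) : R :=
  C.1 0 j.

Definition rhs (R : realType) (n : nat) (C : constraint R n) : R := C.2.

Definition satisfies (R : realType) (n : nat) (C : constraint R n)
    (x : 'rV[R]_n) : Prop :=
  rhs C <= \sum_j coef C j * x 0 j.

(* Variables may be unbounded: a lower bound is a real or -oo, an upper bound
   is a real or +oo. *)
Record mbp (R : realType) (n : nat) : Type := Mbp {
  binary : {set 'I_n};
  glb : 'I_n -> \bar R;
  gub : 'I_n -> \bar R;
  constraints : seq ('rV[R]_n * R);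
  glb_lt_pinfty : forall j, (glb j < +oo)%E;
  gub_gt_ninfty : forall j, (-oo < gub j)%E;
  glb_le_gub : forall j, (glb j <= gub j)%E;
  binary_bounds : forall j, j \in binary -> glb j = 0%E /\ gub j = 1%E
}.

Record state (R : realType) (n : nat) (P : mbp R n) : Type := State {
  lb : 'I_n -> \bar R;
  ub : 'I_n -> \bar R;
  lb_lt_pinfty : forall j, (lb j < +oo)%E;
  ub_gt_ninfty : forall j, (-oo < ub j)%E;
  lb_le_ub : forall j, (lb j <= ub j)%E;
  glb_le_lb : forall j, (glb P j <= lb j)%E;
  ub_le_gub : forall j, (ub j <= gub P j)%E
}.

Definition later_state (R : realType) (n : nat) (P : mbp R n)
    (rho1 rho2 : state P) : Prop :=
  forall j, (lb rho1 j <= lb rho2 j)%E /\ (ub rho2 j <= ub rho1 j)%E.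

Definition in_box (R : realType) (n : nat) (P : mbp R n) (rho : state P)
    (x : 'rV[R]_n) : Prop :=
  forall j, (lb rho j <= (x 0 j)%:E <= ub rho j)%E.

(* The product is that of \bar R, where 0 * +oo = 0 * -oo = 0. *)
Definition max_term (R : realType) (n : nat) (C : constraint R n)
    (l u : 'I_n -> \bar R) (j : 'I_n) : \bar R :=
  Order.max ((coef C j)%:E * l j)%E ((coef C j)%:E * u j)%E.

Definition max_activity (R : realType) (n : nat) (C : constraint R n)
    (l u : 'I_n -> \bar R) : \bar R :=
  (\sum_j max_term C l u j)%E.

Definition derived_bound (R : realType) (n : nat) (P : mbp R n)
    (C : constraint R n) (rho : state P) (s : 'I_n) : \bar R :=
  (((coef C s)^-1)%:E *
     ((rhs C)%:E - \sum_(j | j != s) max_term C (lb rho) (ub rho) j))%E.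

Definition round_lower (R : realType) (n : nat) (P : mbp R n) (s : 'I_n)
    (beta : R) : R :=
  if s \in binary P then (Num.ceil beta)%:~R else beta.

Definition round_upper (R : realType) (n : nat) (P : mbp R n) (s : 'I_n)
    (beta : R) : R :=
  if s \in binary P then (Num.floor beta)%:~R else beta.

Definition propagates (R : realType) (n : nat) (P : mbp R n)
    (C : constraint R n) (rho : state P) (s : 'I_n) : Prop :=
  exists beta : R,
    derived_bound C rho s = beta%:E /\
    ((0 < coef C s /\ (lb rho s < (round_lower P s beta)%:E)%E) \/
     (coef C s < 0 /\ ((round_upper P s beta)%:E < ub rho s)%E)).

(* Relaxing the bounds of x_j to the global ones leaves the maximal activity
   unchanged, see relaxableP.  The condition is stated on x_j alone because an
   infinite term of another variable would hide any change in the value of the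
   sum. *)
Definition relaxable (R : realType) (n : nat) (P : mbp R n)
    (C : constraint R n) (rho : state P) (j : 'I_n) : Prop :=
  [\/ coef C j = 0,
      0 < coef C j /\ ub rho j = gub P j |
      coef C j < 0 /\ lb rho j = glb P j].

Definition replace_at (T : Type) (n : nat) (f g : 'I_n -> T) (j : 'I_n) :
    'I_n -> T :=
  fun i => if i == j then g i else f i.

Section RelaxableP.
Context (R : realType) (n : nat) (P : mbp R n).
Implicit Types (C : constraint R n) (rho : state P) (j : 'I_n).

Let emul_inj (a : R) : a != 0 -> injective (fun x : \bar R => a%:E * x)%E.
Proof.
move=> a0; apply: (can_inj (g := fun x => ((a^-1)%:E * x)%E)) => x.
by rewrite muleA -EFinM mulVf // mul1e.
Qed.

Lemma max_term_pos C (l u : 'I_n -> \bar R) j :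
  (l j <= u j)%E -> 0 < coef C j ->
  max_term C l u j = ((coef C j)%:E * u j)%E.
Proof.
by move=> lu a0; apply/max_idPr; rewrite lee_pmul2l // lte_fin.
Qed.

Lemma max_term_neg C (l u : 'I_n -> \bar R) j :
  (l j <= u j)%E -> coef C j < 0 ->
  max_term C l u j = ((coef C j)%:E * l j)%E.
Proof.
move=> lu a0; apply/max_idPl.
by rewrite -leeN2 -!mulNe -EFinN lee_pmul2l // lte_fin oppr_gt0.
Qed.

Lemma relaxable_max_term C rho j :
  relaxable C rho j <->
  max_term C (lb rho) (ub rho) j = max_term C (glb P) (gub P) j.
Proof.
have lu := lb_le_ub rho j; have glu := glb_le_gub P j.
have [a0|a0|a0] := ltgtP (coef C j) 0.
- rewrite !max_term_neg //; split.
    case=> [a00|[a1 _]|[_ ->] //]; first by rewrite a00 ltxx in a0.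
    by have := lt_trans a0 a1; rewrite ltxx.
  by move=> e; apply: Or33; split=> //; apply: emul_inj e; rewrite lt_eqF.
- rewrite !max_term_pos //; split.
    case=> [a00|[_ ->] //|[a1 _]]; first by rewrite a00 ltxx in a0.
    by have := lt_trans a0 a1; rewrite ltxx.
  by move=> e; apply: Or32; split=> //; apply: emul_inj e; rewrite gt_eqF.
- split=> _; last exact: Or31.
  by rewrite /max_term a0 !mul0e.
Qed.

Lemma relaxableP C rho j :
  max_activity C (lb rho) (ub rho) \is a fin_num ->
  relaxable C rho j <->
  max_activity C (replace_at (lb rho) (glb P) j)
                 (replace_at (ub rho) (gub P) j) =
  max_activity C (lb rho) (ub rho).
Proof.
rewrite /max_activity (bigD1 j) //= fin_numD => /andP[_ fS].
rewrite (bigD1 j) //=.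
have -> : max_term C (replace_at (lb rho) (glb P) j)
    (replace_at (ub rho) (gub P) j) j = max_term C (glb P) (gub P) j.
  by rewrite /max_term /replace_at eqxx.
under eq_bigr => i /negbTE ij do rewrite /max_term /replace_at ij.
rewrite relaxable_max_term; split=> [->//|e].
by have := congr1 (fun x => x - \sum_(i < n | i != j)
  max_term C (lb rho) (ub rho) i)%E e; rewrite !addeK.
Qed.

End RelaxableP.

(* The bound of x_c that enters the maximal activity of Creason under rho2 is
   the one that Ccont sets in rho1.  Since x_c is continuous, that bound is the
   unrounded derived_bound. *)
Definition nonrelaxable_bound_change (R : realType) (n : nat) (P : mbp R n)
    (Ccont Creason : constraint R n) (rho1 rho2 : state P) (c : 'I_n) : Prop :=
  ~ relaxable Creason rho2 c /\
  ([/\ 0 < coef Ccont c, coef Creason c < 0 &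
       lb rho2 c = derived_bound Ccont rho1 c] \/
   [/\ coef Ccont c < 0, 0 < coef Creason c &
       ub rho2 c = derived_bound Ccont rho1 c]).

Definition lincomb (R : realType) (n : nat) (lam : R) (C : constraint R n)
    (mu : R) (D : constraint R n) : constraint R n :=
  (lam *: C.1 + mu *: D.1, lam * C.2 + mu * D.2).

(* The eliminating combination is unique only up to positive scaling, so it is
   given as a predicate. *)
Definition eliminating_combination (R : realType) (n : nat)
    (C D : constraint R n) (c : 'I_n) (E : constraint R n) : Prop :=
  exists lam mu : R,
    [/\ 0 < lam, 0 < mu, E = lincomb lam C mu D & coef E c = 0].

Definition same_or_better_bound (R : realType) (n : nat) (P : mbp R n)
    (C Creason : constraint R n) (rho : state P) (r : 'I_n) : Prop :=
  forall x : 'rV[R]_n, in_box rho x -> satisfies C x ->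
    (0 < coef Creason r -> (derived_bound Creason rho r <= (x 0 r)%:E)%E) /\
    (coef Creason r < 0 -> ((x 0 r)%:E <= derived_bound Creason rho r)%E).

(* Main.v *)
Require Import Defs.
From mathcomp Require Import all_boot all_order all_algebra.
From mathcomp Require Import reals constructive_ereal.

(** Let x be a point of the box of [rho2] that satisfies an eliminating
    combination lam * Creason + mu * Ccont.  The combination does not see x_c,
    so it also holds at the point y obtained from x by moving x_c to the bound
    that Ccont propagated.  At that value of x_c, Ccont has nothing to spare:
    the bound was computed by letting every other variable contribute its
    maximum over the box of [rho1], and y lies in that box, so the activity of
    Ccont at y is at most its right-hand side
    ([activity_at_derived_bound_le]).  The combination can then only hold at y
    because Creason does ([lincomb_satisfies_left]).  Nonrelaxability says that
    the propagated bound is still a local bound of x_c in [rho2]; hence y stays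
    in the box of [rho2], and the soundness of bound propagation
    ([derived_bound_valid]) gives the bound of Creason on y_r, which is x_r. *)

Import Order.TTheory GRing.Theory Num.Theory.
Local Open Scope ring_scope.

Section Propagation.
Context {R : realType} {n : nat} {P : mbp R n}.
Implicit Types (C D : constraint R n) (rho : state P) (x y : 'rV[R]_n).
Implicit Types (s c : 'I_n).

Lemma in_box_later rho1 rho2 x :
  later_state rho1 rho2 -> in_box rho2 x -> in_box rho1 x.
Proof.
move=> later xbox j; have [l u] := later j; have /andP[xl xu] := xbox j.
by rewrite (le_trans l xl) (le_trans xu u).
Qed.

Lemma term_le_max_term C rho x j :
  in_box rho x ->
  ((coef C j * x 0 j)%:E <= max_term C (lb rho) (ub rho) j)%E.
Proof.
move=> /(_ j)/andP[xl xu]; rewrite EFinM /max_term le_max; apply/orP.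
have [a0|/ltW a0] := leP 0 (coef C j); [right|left].
  by rewrite lee_wpmul2l // lee_fin.
by rewrite -leeN2 -!mulNe -EFinN lee_wpmul2l // lee_fin oppr_ge0.
Qed.

Lemma partial_activity_le C rho x s :
  in_box rho x ->
  ((\sum_(j | j != s) coef C j * x 0 j)%:E <=
     \sum_(j | j != s) max_term C (lb rho) (ub rho) j)%E.
Proof.
by move=> xbox; rewrite -sumEFin; apply: lee_sum => j _; exact: term_le_max_term.
Qed.

(** Soundness of bound propagation: the variables other than x_s contribute at
    most their maximal terms, and C has to make up the rest with x_s.  The
    derived bound may be infinite here, since the argument only compares
    extended reals. *)
Lemma derived_bound_valid C rho s :
  same_or_better_bound C C rho s.
Proof.
move=> x xbox; rewrite /satisfies (bigD1 s) //= -lerBlDr => Cx.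
have rest : ((rhs C)%:E - \sum_(j | j != s) max_term C (lb rho) (ub rho) j
    <= (coef C s * x 0 s)%:E)%E.
  apply: le_trans (_ : _ <= (rhs C - \sum_(j | j != s) coef C j * x 0 j)%:E)%E _.
    by rewrite EFinB leeD2l // leeN2 partial_activity_le.
  by rewrite lee_fin.
split=> a0; rewrite /derived_bound.
  have -> : x 0 s = (coef C s)^-1 * (coef C s * x 0 s).
    by rewrite mulKf // lt0r_neq0.
  by rewrite EFinM lee_wpmul2l // lee_fin invr_ge0 ltW.
have -> : x 0 s = (coef C s)^-1 * (coef C s * x 0 s).
  by rewrite mulKf // ltr0_neq0.
rewrite EFinM -leeN2 -!mulNe -EFinN lee_wpmul2l // lee_fin.
by rewrite oppr_ge0 invr_le0 ltW.
Qed.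

(** The derived bound is the value of x_s at which C becomes tight when all the
    other variables are at their most favourable; at any other point of the box
    with this value of x_s, they contribute no more. *)
Lemma activity_at_derived_bound_le C rho s x :
  coef C s != 0 -> in_box rho x -> derived_bound C rho s = (x 0 s)%:E ->
  \sum_j coef C j * x 0 j <= rhs C.
Proof.
move=> a0 xbox xsE; rewrite (bigD1 s) //= -lerBrDl -lee_fin.
apply: le_trans (partial_activity_le C rho x s xbox) _.
have : ((rhs C)%:E - \sum_(j | j != s) max_term C (lb rho) (ub rho) j
    = (coef C s * x 0 s)%:E)%E.
  by rewrite EFinM -xsE /derived_bound muleA -EFinM mulfV // mul1e.
(* An infinite sum of maximal terms would make the derived bound infinite. *)
case: (X in (_ - X)%E) => [S||] //= [<-].
by rewrite lee_fin subKr.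
Qed.

Lemma lincomb_activity (lam mu : R) C D x :
  \sum_j coef (lincomb lam C mu D) j * x 0 j =
  lam * (\sum_j coef C j * x 0 j) + mu * (\sum_j coef D j * x 0 j).
Proof.
rewrite !mulr_sumr -big_split; apply: eq_bigr => j _ /=.
by rewrite /coef !mxE mulrDl !mulrA.
Qed.

Lemma lincomb_satisfies_left (lam mu : R) C D x :
  0 < lam -> 0 <= mu -> \sum_j coef D j * x 0 j <= rhs D ->
  satisfies (lincomb lam C mu D) x -> satisfies C x.
Proof.
move=> lam0 mu0 Dx; rewrite /satisfies lincomb_activity /= => Ex.
rewrite -(ler_pM2l lam0) -(lerD2r (mu * rhs D)).
by apply: le_trans Ex _; rewrite lerD2l ler_wpM2l.
Qed.

Definition set_coord x c (v : R) : 'rV[R]_n :=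
  \row_j (if j == c then v else x 0 j).

Lemma satisfies_set_coord C x c (v : R) :
  coef C c = 0 -> satisfies C x -> satisfies C (set_coord x c v).
Proof.
move=> Cc0; rewrite /satisfies; congr (_ <= _); apply: eq_bigr => j _.
by rewrite mxE; case: eqP => // ->; rewrite Cc0 !mul0r.
Qed.

Lemma in_box_set_coord rho x c (v : R) :
  (lb rho c <= v%:E <= ub rho c)%E -> in_box rho x ->
  in_box rho (set_coord x c v).
Proof. by move=> vc xbox j; rewrite mxE; case: eqP => // ->. Qed.

Lemma eliminating_combination_exists C D c :
  (0 < coef D c /\ coef C c < 0) \/ (coef D c < 0 /\ 0 < coef C c) ->
  exists E, eliminating_combination C D c E.
Proof.
move=> signs; exists (lincomb `|coef D c| C `|coef C c| D).
exists `|coef D c|, `|coef C c|.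
have coefE (lam mu : R) : coef (lincomb lam C mu D) c =
    lam * coef C c + mu * coef D c by rewrite /coef !mxE.
split=> //; rewrite ?coefE ?normr_gt0.
- by case: signs => [[/lt0r_neq0]|[/ltr0_neq0]].
- by case: signs => [[_ /ltr0_neq0]|[_ /lt0r_neq0]].
- case: signs => [[d0 c0]|[d0 c0]].
    by rewrite gtr0_norm // ltr0_norm // mulNr mulrC subrr.
  by rewrite ltr0_norm // gtr0_norm // mulNr mulrC addNr.
Qed.

End Propagation.

Theorem proposition4 (R : realType) (n : nat) (P : mbp R n)
    (Ccont Creason : constraint R n) (rho1 rho2 : state P) (c r : 'I_n)
    (c_neq_r : c != r)
    (c_continuous : c \notin binary P)
    (Ccont_in_P : Ccont \in constraints P)
    (Ccont_propagates : propagates Ccont rho1 c)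
    (rho2_later : later_state rho1 rho2)
    (Creason_propagates : propagates Creason rho2 r)
    (c_nonrelaxable : nonrelaxable_bound_change Ccont Creason rho1 rho2 c) :
  (exists C, eliminating_combination Creason Ccont c C) /\
  (forall C, eliminating_combination Creason Ccont c C ->
     same_or_better_bound C Creason rho2 r).
Proof.
have [v [vE _]] := Ccont_propagates.
have [_ bound_c] := c_nonrelaxable; rewrite vE in bound_c.
split.
  by apply: eliminating_combination_exists; case: bound_c => [[]|[]]; auto.
move=> _ [lam [mu [lam0 mu0 -> elim_c]]] x xbox Ex.
have Ccont_c : coef Ccont c != 0.
  by case: bound_c => [[/lt0r_neq0]|[/ltr0_neq0]].
have v_in : (lb rho2 c <= v%:E <= ub rho2 c)%E.
  have := lb_le_ub rho2 c.
  by case: bound_c => [[_ _ <-]|[_ _ <-]] ->; rewrite lexx.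
pose y := set_coord x c v.
have ybox : in_box rho2 y by exact: in_box_set_coord.
have Ccont_y : \sum_j coef Ccont j * y 0 j <= rhs Ccont.
  apply: (activity_at_derived_bound_le _ rho1 c) => //.
    exact: in_box_later rho2_later ybox.
  by rewrite vE mxE eqxx.
have Creason_y : satisfies Creason y.
  apply: (lincomb_satisfies_left lam mu _ Ccont) => //; first exact: ltW.
  exact: satisfies_set_coord.
have <- : y 0 r = x 0 r by rewrite mxE eq_sym (negbTE c_neq_r).
exact: derived_bound_valid.
Qed.
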